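(* Let $(\mathcal{G}(A,D),p)$ be a framework in $\mathbb{R}^2$ with a node bipartition $\mathcal V=\mathcal V_A\cup\mathcal V_D$, where $\mathcal G$ has $n$ vertices and $m$ edges. Then the SA-RoD rigidity matrix satisfies $\operatorname{rank}(R_{\mathcal{G}(A,D)}(p))\le 2m-n$.
   Context: $\mathcal{G}=(\mathcal V,\mathcal E)$ is a finite simple undirected graph, $\mathcal V=\{1,\dots,n\}$, $n\ge 3$, $m=|\mathcal E|$. A node bipartition is $\mathcal V=\mathcal V_A\cup\mathcal V_D$ with $\mathcal V_A,\mathcal V_D$ disjoint and nonempty; $\mathcal G(A,D)$ denotes $\mathcal G$ with this bipartition. A framework $(\mathcal G(A,D),p)$ has configuration $p=(p_1^\top,\dots,p_n^\top)^\top\in\mathbb R^{2n}$, $p_i\in\mathbb R^2$, with pairwise distinct $p_i$. Set $e_{ij}=p_j-p_i$, $b_{ij}=e_{ij}/\|e_{ij}\|$, and let $\mathcal R(\theta)$ be the counter-clockwise rotation matrix by $\theta$. $\mathcal T_A=\{(u,v,w)\in\mathcal V^3: u\in\mathcal V_A,(u,v),(u,w)\in\mathcal E,v<w\}$, $\mathcal T_D=\{(u,v,w)\in\mathcal V^3: u\in\mathcal V_D,(u,v),(u,w)\in\mathcal E,v<w\}$. For a triplet, $\alpha_{rst}\in[0,2\pi)$ is the signed angle (SA) from $b_{rs}$ to $b_{rt}$ counter-clockwise, and $\kappa_{ijk}=\|e_{ik}\|/\|e_{ij}\|$ is the ratio of distances (RoD). The SA-RoD rigidity matrix $R_{\mathcal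 G(A,D)}(p)\in\mathbb R^{(|\mathcal T_A|+|\mathcal T_D|)\times 2n}$ is the Jacobian with respect to $p$ of $(\ldots,\alpha_{rst},\ldots,\kappa_{ijk},\ldots)^\top$, $(r,s,t)\in\mathcal T_A$, $(i,j,k)\in\mathcal T_D$ (angles being differentiated as quantities modulo $2\pi$). Explicitly, its rows act on $\dot p$ by $\dot\alpha_{rst}=\frac{b_{rs}^\top\mathcal R(\pi/2)}{\|e_{rs}\|}(\dot p_s-\dot p_r)-\frac{b_{rt}^\top\mathcal R(\pi/2)}{\|e_{rt}\|}(\dot p_t-\dot p_r)$ for $(r,s,t)\in\mathcal T_A$, and $\dot\kappa_{ijk}=\kappa_{ijk}\big[\frac{b_{ik}^\top}{\|e_{ik}\|}(\dot p_k-\dot p_i)-\frac{b_{ij}^\top}{\|e_{ij}\|}(\dot p_j-\dot p_i)\big]$ for $(i,j,k)\in\mathcal T_D$.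
   Formalization: The graph is additionally assumed to have no isolated vertices; without this the bound fails, e.g. for a path on three vertices plus one isolated vertex (n=4, m=2), where 2m-n=0 but the rank is 1. *)

(* Defs.v *)
From mathcomp Require Import all_boot all_order all_algebra.
From mathcomp Require Import all_classical all_reals all_analysis.

Set Implicit Arguments.
Unset Strict Implicit.
Unset Printing Implicit Defensive.

Import Order.TTheory GRing.Theory Num.Theory.
Import numFieldNormedType.Exports.

Local Open Scope ring_scope.

(* A simple undirected graph on 'I_n is given by its edge set, whose members
   are unordered pairs of distinct vertices; m is #|E|. *)
Definition simple_graph (n : nat) (E : {set {set 'I_n}}) : Prop :=
  forall a : {set 'I_n}, a \in E -> #|a| = 2%N.

Definition adj (n : nat) (E : {set {set 'I_n}}) (u v : 'I_n) : bool :=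
  [set u; v]%SET \in E.

Definition node_bipartition (n : nat) (VA VD : {set 'I_n}) : Prop :=
  [/\ (VA :|: VD = [set: 'I_n])%SET, [disjoint VA & VD], VA != finset.set0
    & VD != finset.set0].

(* T_A (resp. T_D) is triplets E VA (resp. triplets E VD). *)
Definition triplets (n : nat) (E : {set {set 'I_n}}) (W : {set 'I_n}) :
    {set 'I_n * 'I_n * 'I_n} :=
  [set t : 'I_n * 'I_n * 'I_n |
    [&& t.1.1 \in W, adj E t.1.1 t.1.2, adj E t.1.1 t.2 & (t.1.2 < t.2)%N]].

Section SARoD.
Variable R : realType.

(* The norm `|x| that the library puts on matrices is the sup norm. *)
Definition enorm (x : 'cV[R]_2) : R := Num.sqrt (\sum_i x i 0 ^+ 2).

Definition rot (theta : R) : 'M[R]_2 :=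
  \matrix_(i < 2, j < 2)
    if i == j then cos theta
    else if i == 0 then - sin theta else sin theta.

(* Meaningful for unit vectors x and y, for which exactly one such angle
   exists; the default value 0 is then not used. *)
Definition signed_angle (x y : 'cV[R]_2) : R :=
  xget 0 [set theta : R | 0 <= theta < 2 * pi /\ y = rot theta *m x]%classic.

(* The representative of x modulo 2 pi in [- pi, pi[. *)
Definition wrap (x : R) : R :=
  x - (Num.floor ((x + pi) / (2 * pi)))%:~R * (2 * pi).

Section Framework.
Variable n : nat.
(* mxvec_index orders the coordinates as p_1^T, ..., p_n^T. *)
Definition pos (p : 'rV[R]_(n * 2)) (i : 'I_n) : 'cV[R]_2 :=
  \col_c p 0 (mxvec_index i c).

Definition edge_vec (p : 'rV[R]_(n * 2)) (i j : 'I_n) : 'cV[R]_2 :=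
  pos p j - pos p i.

Definition bearing (p : 'rV[R]_(n * 2)) (i j : 'I_n) : 'cV[R]_2 :=
  (enorm (edge_vec p i j))^-1 *: edge_vec p i j.

Definition sa (t : 'I_n * 'I_n * 'I_n) (p : 'rV[R]_(n * 2)) : R :=
  signed_angle (bearing p t.1.1 t.1.2) (bearing p t.1.1 t.2).

Definition rod (t : 'I_n * 'I_n * 'I_n) (p : 'rV[R]_(n * 2)) : R :=
  enorm (edge_vec p t.1.1 t.2) / enorm (edge_vec p t.1.1 t.1.2).

(* The function q |-> sa t q takes values in [0, 2 pi[ and jumps when the angle
   crosses 0. This is the branch of the angle modulo 2 pi which equals sa t p
   at q = p and has no jump near p, so that its derivative at p is the
   derivative of sa t as a quantity modulo 2 pi. *)
Definition sa_near (p : 'rV[R]_(n * 2)) (t : 'I_n * 'I_n * 'I_n)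
    (q : 'rV[R]_(n * 2)) : R :=
  sa t p + wrap (sa t q - sa t p).

Definition sa_rod_near (E : {set {set 'I_n}}) (VA VD : {set 'I_n})
    (p q : 'rV[R]_(n * 2)) : 'rV[R]_(#|triplets E VA| + #|triplets E VD|) :=
  row_mx (\row_(i < #|triplets E VA|) sa_near p (enum_val i) q)
         (\row_(i < #|triplets E VD|) rod (enum_val i) q).

(* The library's Jacobian 'J acts on row vectors from the right, hence the
   transpose: here row i is the gradient of the i-th component. *)
Definition rigidity_matrix (E : {set {set 'I_n}}) (VA VD : {set 'I_n})
    (p : 'rV[R]_(n * 2)) : 'M[R]_(#|triplets E VA| + #|triplets E VD|, n * 2) :=
  ('J (sa_rod_near E VA VD p) p)^T.

End Framework.
End SARoD.

(* Main.v *)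
(* At a vertex u, each edge uv carries one real function of the configuration:
   the angle by which it has turned if u is in V_A, the logarithm of its length
   if u is in V_D. Near p, the signed angle at u from v to w is, up to a
   constant, the difference of the functions of uw and uv, and the ratio of
   distances is the exponential of such a difference. So the rows of the
   rigidity matrix at u are multiples of differences of deg u fixed vectors,
   hence span a space of dimension at most deg u - 1, as deg u > 0; summing over
   u gives 2m - n. *)
Require Import Defs.
From mathcomp Require Import all_boot all_order all_algebra.
From mathcomp Require Import all_classical all_reals all_analysis.
From mathcomp Require Import ring lra.
Import Order.TTheory GRing.Theory Num.Theory.
Import numFieldNormedType.Exports.
Local Open Scope ring_scope.

(** * Counting darts and bounding the rank of their differences *)

(** A dart is an ordered pair of adjacent vertices. The fibre of [h] over an edge consists of its
    two orientations, which are distinct because an edge has two elements. *)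
Lemma card_darts {n : nat} {E : {set {set 'I_n}}} : simple_graph E ->
  #|[set a : 'I_n * 'I_n | adj E a.1 a.2]| = (2 * #|E|)%N.
Proof.
move=> hE; pose h (a : 'I_n * 'I_n) := [set a.1; a.2]%SET.
rewrite mulnC -sum_nat_const -sum1_card (partition_big h (mem E)) /=; last first.
  by move=> a; rewrite inE.
apply: eq_bigr => e eE; rewrite sum1dep_card.
have /cards2P [x [y [xy eE']]] : #|e| == 2%N by rewrite hE.
have <- : #|[set (x, y); (y, x)]%SET| = 2%N.
  by rewrite cards2 xpair_eqE negb_and xy.
apply: eq_card => -[u v]; rewrite !inE /h /= !xpair_eqE.
apply/andP/orP => [[_ /eqP]|].
  rewrite eE' => uv; move: xy.
  have : x \in [set u; v]%SET by rewrite uv !inE eqxx.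
  have : y \in [set u; v]%SET by rewrite uv !inE eqxx orbT.
  by rewrite !inE; do 2![case/orP=> /eqP ->]; rewrite ?eqxx //; [right|left].
case=> /andP[/eqP -> /eqP ->]; rewrite /adj -?eE' ?eqxx //.
by rewrite finset.setUC -eE' eqxx eE.
Qed.

(* Choosing a reference neighbour r u of each u, every row is a combination of
   the vectors g u v - g u (r u), of which the n with v = r u vanish. *)
Lemma rank_dart_differences {F : fieldType} {n k N : nat}
    {E : {set {set 'I_n}}} (g : 'I_n -> 'I_n -> 'rV[F]_k) (M : 'M[F]_(N, k)) :
    simple_graph E -> (forall u, exists v, adj E u v) ->
    (forall i, exists u v w c,
       [/\ adj E u v, adj E u w & row i M = c *: (g u w - g u v)]) ->
  (\rank M + n <= 2 * #|E|)%N.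
Proof.
move=> hE /fin_all_exists[r hr] hM.
pose D := [set a : 'I_n * 'I_n | adj E a.1 a.2].
pose D0 := [set (u, r u) | u in [set: 'I_n]].
have cD0 : #|D0| = n by rewrite card_imset ?cardsT ?card_ord // => u v [].
have D0D : D0 \subset D.
  by apply/fintype.subsetP => _ /imsetP[u _ ->]; rewrite inE.
(* The [n] reference darts [D0] cancel against the summand [n], so the rank is to be bounded by the
   number of remaining darts. *)
rewrite -(card_darts hE) -[X in (_ + X)%N]cD0 -/D -(cardsID D0 D).
rewrite (finset.setIidPr D0D) addnC leq_add2l.
pose h (a : 'I_n * 'I_n) := g a.1 a.2 - g a.1 (r a.1).
have hS u v : adj E u v -> (h (u, v) <= \sum_(a in (D :\: D0)%SET) <<h a>>)%MS.
  move=> uv; have [uv0|uv0] := boolP ((u, v) \in D0).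
    have /imsetP[u0 _ [-> ->]] := uv0.
    by rewrite /h /= subrr sub0mx.
  by apply: (sumsmx_sup (u, v)); rewrite ?genmxE //; rewrite !inE uv0.
apply: leq_trans (_ : \rank (\sum_(a in (D :\: D0)%SET) <<h a>>)%MS <= _)%N.
  apply: mxrankS; apply/row_subP => i.
  have [u [v [w [c [uv uw ->]]]]] := hM i.
  have -> : g u w - g u v = h (u, w) - h (u, v).
    by rewrite /h /= opprB addrA subrK.
  by rewrite scalemx_sub // addmx_sub ?eqmx_opp ?hS.
(* Rank is subadditive and each summand is spanned by a single row. *)
rewrite -sum1_card; elim/big_rec2: _ => [|a s m _ IH]; first by rewrite mxrank0.
apply: leq_trans (mxrank_adds_leqif _ _).1 _; rewrite genmxE.
by rewrite leq_add ?rank_leq_row.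
Qed.

(** * Differentials of locally equal functions and entries of the Jacobian *)

Local Open Scope classical_set_scope.

(** The first-order expansion of [g] only concerns points near [x], so it also holds for [f], and
    uniqueness identifies the differentials. This allows [sa_near] and [rod] to be replaced by
    smooth local expressions. *)
Lemma near_eq_is_diff {R : numFieldType} {V W : normedModType R}
    (f g df : V -> W) (x : V) :
  (\forall y \near x, f y = g y) -> is_diff x g df -> is_diff x f df.
Proof.
move=> fg [dg <-]; have fgx := nbhs_singleton fg.
have [dgc gE] := (diff_locallyP _ _).1 dg.
have fE : f \o shift x = cst (f x) + 'd g x +o_ 0 id.
  apply/eqaddoP => _/posnumP[e].
  have /eqaddoP /(_ e%:num) /(_ [gt0 of e%:num]) := gE.
  rewrite (near_shift 0 x) subr0 in fg.
  rewrite !near_simpl.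
  apply: filter_app; near=> h => /=; rewrite !fctE /= fgx.
  by have -> : f (h + x) = g (h + x) by near: h.
have dfg := diff_unique dgc fE.
by apply: DiffDef => //; apply/diff_locallyP; rewrite dfg.
Unshelve. all: by end_near. Qed.

Lemma jacobianE {R : realFieldType} {k N : nat} (f : 'rV[R]_k -> 'rV[R]_N)
    (p : 'rV[R]_k) :
  (forall j, differentiable (fun q => f q 0 j) p) ->
  forall i j, 'J f p i j = 'd (fun q => f q 0 j) p (delta_mx 0 i).
Proof.
move=> df i j.
have fE : f = \sum_(j < N) (fun q => f q 0 j *: delta_mx 0 j).
  by apply/funext => q; rewrite fct_sumE; exact: row_sum_delta.
have dif : differentiable f p.
  rewrite fE; apply: differentiable_sum => l.
  exact: differentiableZl.
by rewrite mxE -deriveE // derive_mx ?mxE ?deriveE //; exact: diff_derivable.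
Qed.

(* The sequence rotation seq.rot and ssreflect's wrap shadow these. *)
Local Notation rot := Defs.rot.
Local Notation wrap := Defs.wrap.

(** * Rotations and angles in the plane *)

Section PlaneRotations.
Context {R : realType}.
Implicit Types (x y : 'cV[R]_2) (a b : R) (k : int).

Definition dot x y : R := x 0 0 * y 0 0 + x 1 0 * y 1 0.
Definition cross x y : R := x 0 0 * y 1 0 - x 1 0 * y 0 0.

Lemma cV2P x y : x 0 0 = y 0 0 -> x 1 0 = y 1 0 -> x = y.
Proof.
move=> e0 e1; apply/matrixP => i j; rewrite (ord1 j).
case: i => -[|[|//]] hi; first by rewrite (_ : Ordinal hi = 0) //; exact/val_inj.
by rewrite (_ : Ordinal hi = 1) //; exact/val_inj.
Qed.

Lemma sum_ord2 (F : 'I_2 -> R) : \sum_i F i = F 0 + F 1.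
Proof. by rewrite big_ord_recr big_ord1; congr (F _ + F _); exact/val_inj. Qed.

Lemma enormE x : enorm x = Num.sqrt (dot x x).
Proof. by rewrite /enorm sum_ord2. Qed.

Lemma dotxx_ge0 x : 0 <= dot x x.
Proof. by rewrite /dot -!expr2 addr_ge0 ?sqr_ge0. Qed.

Lemma enorm_sqr x : enorm x ^+ 2 = dot x x.
Proof. by rewrite enormE sqr_sqrtr ?dotxx_ge0. Qed.

Lemma enorm_gt0 x : (0 < enorm x) = (x != 0).
Proof.
rewrite enormE sqrtr_gt0 lt_neqAle dotxx_ge0 andbT eq_sym /dot -!expr2.
rewrite paddr_eq0 ?sqr_ge0 // !sqrf_eq0; congr (~~ _).
apply/andP/eqP => [[/eqP e0 /eqP e1]|->]; last by rewrite !mxE.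
by apply: cV2P; rewrite mxE.
Qed.

Lemma dotZZ a x : dot (a *: x) (a *: x) = a ^+ 2 * dot x x.
Proof. by rewrite /dot !mxE; ring. Qed.

Lemma dot_gt0_neq0 x y : 0 < dot x y -> x != 0 /\ y != 0.
Proof.
by move=> d; split; apply: contraTneq d => ->;
  rewrite /dot !mxE ?mulr0 ?mul0r addr0 ltxx.
Qed.

(** Lagrange's identity in dimension two. *)
Lemma dot_cross_sqr x y :
  dot x y ^+ 2 + cross x y ^+ 2 = enorm x ^+ 2 * enorm y ^+ 2.
Proof. by rewrite !enorm_sqr /dot /cross; ring. Qed.

Lemma rotE0 a x : (rot a *m x) 0 0 = cos a * x 0 0 - sin a * x 1 0.
Proof. by rewrite mxE sum_ord2 ![rot _ _ _]mxE /= mulNr. Qed.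

Lemma rotE1 a x : (rot a *m x) 1 0 = sin a * x 0 0 + cos a * x 1 0.
Proof. by rewrite mxE sum_ord2 ![rot _ _ _]mxE. Qed.

Lemma rotD a b x : rot (a + b) *m x = rot a *m (rot b *m x).
Proof. by apply: cV2P; rewrite !(rotE0, rotE1) cosD sinD; ring. Qed.

Lemma rot0 x : rot 0 *m x = x.
Proof. by apply: cV2P; rewrite !(rotE0, rotE1) cos0 sin0; ring. Qed.

Lemma rotNK a x : rot (- a) *m (rot a *m x) = x.
Proof. by rewrite -rotD addNr rot0. Qed.

Lemma rotD2pi a k x : rot (a + k%:~R * (2 * pi)) *m x = rot a *m x.
Proof.
have h b (n : nat) : rot (b + n%:R * (2 * pi)) *m x = rot b *m x.
  have -> : b + n%:R * (2 * pi) = b + (pi *+ 2) *+ n.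
    by rewrite -[(pi *+ 2) *+ n]mulr_natl -[pi *+ 2]mulr_natl.
  apply: cV2P; rewrite !(rotE0, rotE1);
    by rewrite (periodicn (@cosD2pi R)) (periodicn (@sinD2pi R)).
case: k => n; first exact: h.
by rewrite -[RHS](h _ n.+1) NegzE mulrNz mulNr -(h _ n.+1) subrK h.
Qed.

Lemma reduce_mod_2pi a : exists k, 0 <= a - k%:~R * (2 * pi) < 2 * pi.
Proof.
have pi2 : 0 < 2 * pi :> R by rewrite mulr_gt0 ?pi_gt0.
have /andP[ka ak] := floor_itv (a / (2 * pi)).
exists (Num.floor (a / (2 * pi))).
rewrite subr_ge0 -ler_pdivlMr // ka /= ltrBlDr -[X in X + _]mul1r -mulrDl.
by rewrite -ltr_pdivrMr // addrC -[1]/(1%:~R) -intrD.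
Qed.

(** One has [cos a = 1 - 2 sin^2 (a / 2)], and [sin (a / 2)] is positive for [0 < a < 2 pi]. *)
Lemma cos_eq1 a : 0 <= a < 2 * pi -> cos a = 1 -> a = 0.
Proof.
move=> /andP[a0 a2]; have [//|aN0] := eqVneq a 0.
have s0 : 0 < sin (a / 2).
  have a_gt0 : 0 < a by rewrite lt_neqAle eq_sym aN0.
  by apply: sin_gt0_pi; apply/andP; split; lra.
have -> : a = (a / 2) *+ 2 by rewrite -mulr_natr divfK.
rewrite cos_mulr2n cos2sin2 => h; nra.
Qed.

(** With [r] the residue of [a] in [[0, 2 pi[], the inner product of [x] with [rot r *m x = x] gives
    [cos r = 1]. *)
Lemma rot_fixed_unit a x : x != 0 -> rot a *m x = x ->
  exists k, a = k%:~R * (2 * pi).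
Proof.
move=> x0 ax; have [k hk] := reduce_mod_2pi a; exists k.
pose r := a - k%:~R * (2 * pi); apply/subr0_eq/cos_eq1 => //.
rewrite -/r; have : rot r *m x = x.
  by rewrite -[RHS]ax -(rotD2pi r k) subrK.
move=> /matrixP h; have := h 0 0; have := h 1 0; rewrite rotE0 rotE1 => h1 h0.
have : 0 < dot x x by rewrite -enorm_sqr exprn_gt0 ?enorm_gt0.
rewrite /dot => d0; apply: (mulIf (lt0r_neq0 d0)).
rewrite mul1r; transitivity (x 0 0 * (cos r * x 0 0 - sin r * x 1 0) +
    x 1 0 * (sin r * x 0 0 + cos r * x 1 0)); first by ring.
by rewrite h0 h1.
Qed.

(** The angle must have cosine [dot x y] and sine [cross x y]; [acos] determines it up to sign, and
    the sign of [cross x y] decides. *)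
Lemma exists_rot x y : enorm x = 1 -> enorm y = 1 -> exists a, y = rot a *m x.
Proof.
move=> x1 y1; have := dot_cross_sqr x y.
rewrite x1 y1 expr1n mulr1; set c := dot x y; set s := cross x y => cs.
have c1 : -1 <= c <= 1 by apply/andP; split; nra.
have hx := enorm_sqr x; rewrite x1 expr1n /dot in hx.
have [a [ca sa]] : exists a, cos a = c /\ sin a = s.
  have cK : cos (acos c) = c by apply: acosK; rewrite in_itv.
  have sK : sin (acos c) = `|s|.
    by rewrite sin_acos // -sqrtr_sqr; congr Num.sqrt; rewrite -cs addrC addKr.
  have [s0|s0] := leP 0 s; first by exists (acos c); rewrite cK sK ger0_norm.
  by exists (- acos c); rewrite cosN sinN cK sK ltr0_norm ?opprK.
by exists a; apply: cV2P; rewrite ?rotE0 ?rotE1 ca sa /c /s /dot /cross;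
  rewrite -[LHS]mul1r hx; ring.
Qed.

Lemma signed_angleP x y : enorm x = 1 -> enorm y = 1 ->
  y = rot (signed_angle x y) *m x.
Proof.
move=> x1 y1; have [a ya] := exists_rot x y x1 y1.
have [k hk] := reduce_mod_2pi a.
rewrite /signed_angle; case: xgetP => [b _ [_ //]|].
(* The reduced angle is a witness in [[0, 2 pi[], so the default value of [xget] is excluded. *)
move=> /(_ (a - k%:~R * (2 * pi))) []; split=> //.
by rewrite -mulNr -mulrNz rotD2pi.
Qed.

Lemma wrapD2pi a k : - pi <= a < pi -> wrap (a + k%:~R * (2 * pi)) = a.
Proof.
move=> /andP[ga al]; rewrite /wrap.
have pi2 : 0 < 2 * pi :> R by rewrite mulr_gt0 ?pi_gt0.
rewrite (_ : Num.floor _ = k) ?addrK //; apply/eqP.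
rewrite floor_eq; apply/andP; split.
  by rewrite ler_pdivlMr //; lra.
by rewrite ltr_pdivrMr // intrD mulrDl; lra.
Qed.

(** For [dot x y > 0] this is the oriented angle from [x] to [y], in a form that is differentiable
    in the coordinates. *)
Definition relative_angle x y : R := atan (cross x y / dot x y).

Lemma relative_angle_bounds x y : - (pi / 2) < relative_angle x y < pi / 2.
Proof. by rewrite atan_gtNpi2 atan_ltpi2. Qed.

(** Positivity of [dot x y] puts the angle in the open right half-plane, where [atan] recovers both
    its cosine and its sine. *)
Lemma rot_relative_angle x y : 0 < dot x y ->
  (enorm y)^-1 *: y = rot (relative_angle x y) *m ((enorm x)^-1 *: x).
Proof.
move=> d0; have dN0 := lt0r_neq0 d0.
have [xN0 yN0] := dot_gt0_neq0 _ _ d0.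
have x0 : 0 < enorm x by rewrite enorm_gt0.
have y0 : 0 < enorm y by rewrite enorm_gt0.
have ca : cos (relative_angle x y) = dot x y / (enorm x * enorm y).
  rewrite /relative_angle cos_atan -[RHS]invrK; congr (_^-1).
  rewrite -[RHS]gtr0_norm ?invr_gt0 ?divr_gt0 ?mulr_gt0 // -sqrtr_sqr.
  congr Num.sqrt; rewrite invf_div !expr_div_n exprMn -dot_cross_sqr.
  by field.
have sa : sin (relative_angle x y) = cross x y / (enorm x * enorm y).
  have := atanK (cross x y / dot x y); rewrite -/(relative_angle x y) /tan ca.
  set s := sin _ => sE.
  have {sE} := congr1 ( *%R^~ (dot x y / (enorm x * enorm y))) sE.
  rewrite divfK ?mulf_neq0 ?invr_eq0 ?mulf_neq0 ?lt0r_neq0 // => ->.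
  by rewrite mulrA divfK.
(* After multiplication by [enorm y * enorm x ^+ 2], expanding [enorm x ^+ 2] on the left leaves an
   identity in the coordinates. *)
have hx := enorm_sqr x.
by apply: cV2P; rewrite !(rotE0, rotE1) ca sa !mxE;
  apply: (mulIf (mulf_neq0 (lt0r_neq0 y0) (expf_neq0 2 (lt0r_neq0 x0))));
  rewrite [in LHS]hx /dot /cross; field; rewrite ?lt0r_neq0.
Qed.

End PlaneRotations.

(** * Edge angles and edge lengths as local coordinates of a framework *)

Section Framework.
Context {R : realType} {n : nat}.
Implicit Types (p q : 'rV[R]_(n * 2)) (u v w : 'I_n).

Lemma differentiable_edge_vec u v p i :
  differentiable (fun q => edge_vec q u v i 0) p.
Proof.
have -> : (fun q => edge_vec q u v i 0) =
    (fun q => q 0 (mxvec_index v i)) - (fun q => q 0 (mxvec_index u i)).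
  by apply/funext => q; rewrite !fctE !mxE.
by apply: differentiableB; exact: differentiable_coord.
Qed.

Lemma differentiable_dot (f g : 'rV[R]_(n * 2) -> 'cV[R]_2) p :
  (forall i, differentiable (fun q => f q i 0) p) ->
  (forall i, differentiable (fun q => g q i 0) p) ->
  differentiable (fun q => dot (f q) (g q)) p.
Proof.
move=> df dg.
exact: differentiableD (differentiableM (df 0) (dg 0))
  (differentiableM (df 1) (dg 1)).
Qed.

Lemma differentiable_cross (f g : 'rV[R]_(n * 2) -> 'cV[R]_2) p :
  (forall i, differentiable (fun q => f q i 0) p) ->
  (forall i, differentiable (fun q => g q i 0) p) ->
  differentiable (fun q => cross (f q) (g q)) p.
Proof.
move=> df dg.
exact: differentiableB (differentiableM (df 0) (dg 1))
  (differentiableM (df 1) (dg 0)).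
Qed.

(* The angle turned by the edge from u to v when moving from p to q. *)
Definition edge_angle p u v q : R :=
  relative_angle (edge_vec p u v) (edge_vec q u v).

Definition edge_log_length u v q : R := ln (enorm (edge_vec q u v)).

Lemma differentiable_edge_angle p u v : edge_vec p u v != 0 ->
  differentiable (edge_angle p u v) p.
Proof.
move=> e0; apply: (@differentiable_comp _ _ _ _ _ (@atan R)); last first.
  by apply/derivable1_diffP; exact: derivable_atan.
have d_edge i := differentiable_edge_vec u v p i.
have d_cst i : differentiable (fun _ : 'rV[R]_(n * 2) => edge_vec p u v i 0) p.
  exact: differentiable_cst.
apply: differentiableM; first exact: differentiable_cross.
apply: differentiableV; first exact: differentiable_dot.
by rewrite -enorm_sqr expf_neq0 // lt0r_neq0 // enorm_gt0.
Qed.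

Lemma differentiable_edge_log_length p u v : edge_vec p u v != 0 ->
  differentiable (edge_log_length u v) p.
Proof.
move=> e0; have e_gt0 : 0 < enorm (edge_vec p u v) by rewrite enorm_gt0.
apply: (@differentiable_comp _ _ _ _ _ (@ln R)); last first.
  by apply/derivable1_diffP; apply: ex_derive; exact: is_derive1_ln.
rewrite (_ : (fun q => _) =
    @Num.sqrt R \o (fun q => dot (edge_vec q u v) (edge_vec q u v))); last first.
  by apply/funext => q; rewrite enormE.
apply: differentiable_comp.
  by apply: differentiable_dot => i; exact: differentiable_edge_vec.
apply/derivable1_diffP; apply: ex_derive; apply: is_derive1_sqrt.
by rewrite -enorm_sqr exprn_gt0.
Qed.

(** By continuity, since the value at [q = p] is a squared length. Near [p] the edge thus stays
    nonzero and turns by less than a quarter turn. *)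
Lemma near_dot_gt0 p u v : edge_vec p u v != 0 ->
  \forall q \near p, 0 < dot (edge_vec p u v) (edge_vec q u v).
Proof.
move=> e0.
have : differentiable (fun q => dot (edge_vec p u v) (edge_vec q u v)) p.
  by apply: differentiable_dot => i;
    [exact: differentiable_cst | exact: differentiable_edge_vec].
move=> /differentiable_continuous /cvgr_gt; apply.
by rewrite -enorm_sqr exprn_gt0 // enorm_gt0.
Qed.

Lemma edge_vec_neq0 p u v : injective (pos p) -> u != v -> edge_vec p u v != 0.
Proof. by move=> hp; rewrite subr_eq0 (inj_eq hp) eq_sym. Qed.

Lemma enorm_bearing p u v : edge_vec p u v != 0 -> enorm (bearing p u v) = 1.
Proof.
rewrite -enorm_gt0 => e0; rewrite enormE -[RHS]sqrtr1; congr Num.sqrt.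
by rewrite dotZZ -enorm_sqr -exprMn mulVf ?expr1n // lt0r_neq0.
Qed.

Lemma sa_near_edge_angle p (t : 'I_n * 'I_n * 'I_n) :
  edge_vec p t.1.1 t.1.2 != 0 -> edge_vec p t.1.1 t.2 != 0 ->
  \forall q \near p, sa_near p t q =
    sa t p + (edge_angle p t.1.1 t.2 q - edge_angle p t.1.1 t.1.2 q).
Proof.
move: t => [[u v] w] /= v0 w0; near=> q.
have dv : 0 < dot (edge_vec p u v) (edge_vec q u v).
  by near: q; exact: near_dot_gt0.
have dw : 0 < dot (edge_vec p u w) (edge_vec q u w).
  by near: q; exact: near_dot_gt0.
have bv : bearing q u v = rot (edge_angle p u v q) *m bearing p u v.
  exact: rot_relative_angle.
have bw : bearing q u w = rot (edge_angle p u w q) *m bearing p u w.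
  exact: rot_relative_angle.
have sp : bearing p u w = rot (sa (u, v, w) p) *m bearing p u v.
  by apply: signed_angleP; exact: enorm_bearing.
have sq : bearing q u w = rot (sa (u, v, w) q) *m bearing q u v.
  by have [_ ?] := dot_gt0_neq0 _ _ dv; have [_ ?] := dot_gt0_neq0 _ _ dw;
    apply: signed_angleP; exact: enorm_bearing.
have b0 : bearing p u v != 0.
  by rewrite -enorm_gt0 enorm_bearing.
(* The bearing of [uv] at [p] reaches that of [uw] at [q] in two ways: through [uw] at [p] or
   through [uv] at [q]. The two total angles agree modulo [2 pi]. *)
have [|k hk] := rot_fixed_unit (- (edge_angle p u w q + sa (u, v, w) p) +
    (sa (u, v, w) q + edge_angle p u v q)) _ b0.
  rewrite rotD (rotD (sa (u, v, w) q)) -bv -sq bw sp.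
  by rewrite -(rotD _ (sa (u, v, w) p)) rotNK.
rewrite /sa_near; congr (_ + _).
(* Each edge angle lies strictly between [- pi / 2] and [pi / 2], so their difference lies in the
   range of [wrap]. *)
rewrite -[RHS](wrapD2pi _ k); first by rewrite -hk; congr (wrap _); ring.
have /andP[? ?] := relative_angle_bounds (edge_vec p u v) (edge_vec q u v).
have /andP[? ?] := relative_angle_bounds (edge_vec p u w) (edge_vec q u w).
rewrite /edge_angle; apply/andP; split; lra.
Unshelve. all: by end_near. Qed.

Lemma rod_edge_log_length p (t : 'I_n * 'I_n * 'I_n) :
  edge_vec p t.1.1 t.1.2 != 0 -> edge_vec p t.1.1 t.2 != 0 ->
  rod t p =
    expR (edge_log_length t.1.1 t.2 p - edge_log_length t.1.1 t.1.2 p).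
Proof.
rewrite -!enorm_gt0 => v0 w0.
by rewrite expRD expRN !lnK.
Qed.

Lemma near_rod_edge_log_length p (t : 'I_n * 'I_n * 'I_n) :
  edge_vec p t.1.1 t.1.2 != 0 -> edge_vec p t.1.1 t.2 != 0 ->
  \forall q \near p, rod t q =
    expR (edge_log_length t.1.1 t.2 q - edge_log_length t.1.1 t.1.2 q).
Proof.
move=> v0 w0; near=> q.
apply: rod_edge_log_length.
  suff dv : 0 < dot (edge_vec p t.1.1 t.1.2) (edge_vec q t.1.1 t.1.2).
    by case: (dot_gt0_neq0 _ _ dv).
  by near: q; exact: near_dot_gt0.
suff dw : 0 < dot (edge_vec p t.1.1 t.2) (edge_vec q t.1.1 t.2).
  by case: (dot_gt0_neq0 _ _ dw).
by near: q; exact: near_dot_gt0.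
Unshelve. all: by end_near. Qed.

Lemma is_diff_sa_near p t :
  edge_vec p t.1.1 t.1.2 != 0 -> edge_vec p t.1.1 t.2 != 0 ->
  is_diff p (sa_near p t)
    (fun h => 'd (edge_angle p t.1.1 t.2) p h -
              'd (edge_angle p t.1.1 t.1.2) p h).
Proof.
move=> v0 w0; apply: near_eq_is_diff (sa_near_edge_angle _ _ v0 w0) _.
have dv := differentiableP (differentiable_edge_angle _ _ _ v0).
have dw := differentiableP (differentiable_edge_angle _ _ _ w0).
apply: is_diff_eq (is_diffD (is_diff_cst _ p) (is_diffB dw dv)) _.
by apply/funext => h; rewrite !fctE add0r.
Qed.

(** The exponential is its own derivative, so the chain rule leaves the factor [rod t p]. *)
Lemma is_diff_rod p t :
  edge_vec p t.1.1 t.1.2 != 0 -> edge_vec p t.1.1 t.2 != 0 ->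
  is_diff p (rod t)
    (fun h => rod t p * ('d (edge_log_length t.1.1 t.2) p h -
                         'd (edge_log_length t.1.1 t.1.2) p h)).
Proof.
move=> v0 w0; apply: near_eq_is_diff (near_rod_edge_log_length _ _ v0 w0) _.
have dv := differentiableP (differentiable_edge_log_length _ _ _ v0).
have dw := differentiableP (differentiable_edge_log_length _ _ _ w0).
have de x : is_diff x (@expR R) ( *:%R^~ (expR x)).
  have dex : derivable expR x 1 by exact: derivable_expR.
  apply: DiffDef; first exact/derivable1_diffP.
  by rewrite deriv1E // derive1E derive_val.
apply: is_diff_eq (is_diff_comp (is_diffB dw dv) (de _)) _.
by apply/funext => h /=; rewrite mulrC rod_edge_log_length.
Qed.

End Framework.

Local Close Scope classical_set_scope.

(** * Rows of the rigidity matrix as multiples of dart differences *)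

Theorem lemma1 (R : realType) (n : nat) (hn : (3 <= n)%N)
    (E : {set {set 'I_n}}) (hE : simple_graph E)
    (no_isolated : forall u : 'I_n, exists v : 'I_n, adj E u v)
    (VA VD : {set 'I_n}) (hAD : node_bipartition VA VD)
    (p : 'rV[R]_(n * 2)) (hp : injective (pos p)) :
  ((\rank (rigidity_matrix E VA VD p))%:Z <= 2 * #|E|%:Z - n%:Z)%R.
Proof.
have adj_neq u v : adj E u v -> u != v.
  by move=> /hE; rewrite cards2; case: eqVneq.
have e0 u v : adj E u v -> edge_vec p u v != 0.
  by move=> /adj_neq; exact: edge_vec_neq0.
have [_ dis _ _] := hAD.
pose phi u v := if u \in VA then edge_angle p u v else edge_log_length u v.
(* The scalar [c] is 1 for a signed angle and the ratio itself for a ratio of distances. *)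
have entry j : exists u v w c, [/\ adj E u v, adj E u w &
    is_diff p (fun q => sa_rod_near E VA VD p q 0 j)
      (fun h => c * ('d (phi u w) p h - 'd (phi u v) p h))].
  case: (split_ordP j) => i ->; have := enum_valP i;
    rewrite inE => /and4P[uW uv uw _].
    exists (enum_val i).1.1, (enum_val i).1.2, (enum_val i).2, 1.
    split=> //; rewrite /phi uW.
    have -> : (fun q => sa_rod_near E VA VD p q 0 (lshift _ i)) =
        sa_near p (enum_val i).
      by apply/funext => q; rewrite row_mxEl mxE.
    apply: is_diff_eq (is_diff_sa_near _ _ (e0 _ _ uv) (e0 _ _ uw)) _.
    by apply/funext => h; rewrite mul1r.
  exists (enum_val i).1.1, (enum_val i).1.2, (enum_val i).2.
  exists (rod (enum_val i) p).
  (* A vertex of [VD] is not in [VA], so [phi] is the log-length there. *)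
  split=> //; rewrite /phi (disjointFl dis uW).
  have -> : (fun q => sa_rod_near E VA VD p q 0 (rshift _ i)) =
      rod (enum_val i).
    by apply/funext => q; rewrite row_mxEr mxE.
  exact: is_diff_rod _ _ (e0 _ _ uv) (e0 _ _ uw).
rewrite lerBrDr -PoszD -PoszM lez_nat.
(* The vector of a dart is the gradient at [p] of its function [phi u v]. *)
pose g u v : 'rV[R]_(n * 2) := \row_i 'd (phi u v) p (delta_mx 0 i).
apply: (rank_dart_differences g) => // j.
have [u [v [w [c [uv uw dj]]]]] := entry j.
exists u, v, w, c; split=> //.
apply/rowP => i; rewrite mxE /rigidity_matrix [_^T _ _]mxE jacobianE; last first.
  by move=> l; have [? [? [? [? [_ _ []]]]]] := entry l.
by case: dj => _ ->; rewrite !mxE.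
Qed.
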